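(* Let $0<\alpha<1$, $\gamma>0$ and let $N_0$ be a constant. Then the function $$N(x)=N_0\,x^{\alpha\gamma-1}\gamma^{\gamma}E^{\gamma}_{(\alpha,\alpha\gamma)}(-\gamma x^{\alpha}),\qquad x>0,$$ is the solution of the fractional integral equation $$N(x)-N_0\,x^{\alpha\gamma-1}\gamma^{\gamma}E^{\gamma-1}_{(\alpha,\alpha\gamma)}(-\gamma x^{\alpha})=-\gamma\;{}_0D_x^{-\alpha}N(x),\qquad x>0.$$
   Context: The generalized (three-parameter) Mittag-Leffler function is $$E^{\delta}_{(\alpha,\beta)}(z)=\sum_{k=0}^{\infty}\frac{(\delta)_k\,z^k}{k!\,\Gamma(\alpha k+\beta)},$$ where $(b)_k=b(b+1)\cdots(b+k-1)$ for $k\ge1$ and $(b)_0=1$ is the Pochhammer symbol (with $(b)_0=1$ also for $b=0$). The operator ${}_0D_x^{-\alpha}$ is the Riemann-Liouville fractional integral of order $\alpha$: $${}_0D_x^{-\alpha}N(x)=\frac{1}{\Gamma(\alpha)}\int_0^x (x-t)^{\alpha-1}N(t)\,dt.$$ Solutions are understood among functions that are integrable on finite intervals $[0,b]$. *)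

(* Defs.v *)
From HB Require Import structures.
From mathcomp Require Import all_boot all_order all_algebra.
From mathcomp Require Import all_classical all_reals all_analysis.

Set Implicit Arguments.
Unset Strict Implicit.
Unset Printing Implicit Defensive.

Import Order.TTheory GRing.Theory Num.Theory.
Import numFieldNormedType.Exports.

Local Open Scope classical_set_scope.
Local Open Scope ring_scope.

(* Euler's integral; it represents the Gamma function for [0 < s] only, which
   is the only range in which it is used below. *)
Definition Gamma (R : realType) (s : R) : R :=
  \int[lebesgue_measure]_(t in `]0, +oo[) (t `^ (s - 1) * expR (- t)).

Definition pochhammer (R : realType) (b : R) (k : nat) : R :=
  \prod_(i < k) (b + i%:R).

(* Three-parameter Mittag-Leffler function E^delta_(alpha, beta)(z) of a real
   variable, for [0 < alpha] and [0 < beta]. *)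
Definition mittag_leffler (R : realType) (delta alpha beta z : R) : R :=
  limn (series (fun k : nat =>
    pochhammer delta k * z ^+ k / (k`!%:R * Gamma (alpha * k%:R + beta)))).

Definition RL_kernel (R : realType) (alpha : R) (N : R -> R) (x t : R) : R :=
  (x - t) `^ (alpha - 1) * N t.

(* Since [Rintegral] is total, the existence of the fractional integral at [x]
   has to be asserted separately. *)
Definition RL_exists (R : realType) (alpha : R) (N : R -> R) (x : R) : Prop :=
  lebesgue_measure.-integrable `[0, x] (EFin \o RL_kernel alpha N x).

Definition RL_integral (R : realType) (alpha : R) (N : R -> R) (x : R) : R :=
  (Gamma alpha)^-1 *
  \int[lebesgue_measure]_(t in `[0, x]) RL_kernel alpha N x t.

Definition integrable_on_finite_intervals (R : realType) (N : R -> R) : Prop :=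
  forall b : R, 0 < b -> lebesgue_measure.-integrable `[0, b] (EFin \o N).

Definition satisfies_at (R : realType) (alpha c : R) (f N : R -> R) (x : R) :
    Prop :=
  RL_exists alpha N x /\ N x - f x = - c * RL_integral alpha N x.

Definition solution (R : realType) (alpha c : R) (f N : R -> R) : Prop :=
  integrable_on_finite_intervals N /\
  forall x : R, 0 < x -> satisfies_at alpha c f N x.

(* The notion of solution for N regarded as an equivalence class modulo almost
   everywhere equality. *)
Definition ae_solution (R : realType) (alpha c : R) (f N : R -> R) : Prop :=
  integrable_on_finite_intervals N /\
  {ae lebesgue_measure, forall x : R, 0 < x -> satisfies_at alpha c f N x}.

(* Main.v *)
Require Import Defs.
From HB Require Import structures.
From mathcomp Require Import all_boot all_order all_algebra.
From mathcomp Require Import all_classical all_reals all_analysis.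
From mathcomp Require Import measurable_realfun ring lra.
Set Implicit Arguments.
Unset Strict Implicit.
Unset Printing Implicit Defensive.
Import Order.TTheory GRing.Theory Num.Theory.
Import numFieldNormedType.Exports.
Local Open Scope classical_set_scope.
Local Open Scope ring_scope.

(**
  Existence rests on the action of fractional integration on powers: by the
  Beta integral, it sends [t `^ (s - 1) / Gamma s] to
  [x `^ (s + alpha - 1) / Gamma (s + alpha)] ([beta_integral]).  Applied term
  by term to the Mittag-Leffler series this raises the order of each term by
  one; multiplied by [- gamma], the result is the difference of the series with
  parameters [gamma] and [gamma - 1], because
  [(gamma)_(k+1) - (gamma - 1)_(k+1) = (k + 1) * (gamma)_k]
  ([pochhammerB1]).  The exchange of sum and integral is dominated convergence
  ([ml_profile_fractional]); the series converges absolutely because Gamma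
  outgrows every geometric sequence ([Gamma_ge]).

  Uniqueness is a contraction argument in a weighted L1 space.  The difference
  [D] of two solutions satisfies almost everywhere
  [`|D x| <= gamma / Gamma alpha * \int_(0 <= t <= x) (x - t) `^ (alpha - 1) * `|D t|].
  In the norm with weight [expR (- l * x)], on a bounded interval, the operator
  on the right has norm at most [gamma * l `^ (- alpha)], which is less than
  one for large [l]; hence [D] vanishes almost everywhere
  ([convolution_gronwall], [fractional_gronwall]).  Solutions that satisfy the
  equation at every point then agree at every point, since fractional
  integrals do not see null sets.

  Both halves use the rule that the Laplace transform of a convolution is the
  product of the transforms ([ge0_laplace_convolution]): at [l = 1] it evaluates
  the Beta integral, and for large [l] it gives the contraction factor.
*)

Local Notation mu := lebesgue_measure.

(** * Affine substitution and the Laplace transform of a convolution *)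

(** Both sides are measures, and they agree on half-open intervals. *)
Lemma lebesgue_measure_affine (R : realType) (c d : R) (A : set R) :
  0 < c -> measurable A ->
  (mu A = c%:E *
    pushforward mu (fun x : measurableTypeR R => c * x + d : measurableTypeR R)%R A)%E.
Proof.
move=> c0 mA.
pose phi := fun x : measurableTypeR R => (c * x + d : measurableTypeR R).
have mphi : measurable_fun setT phi.
  by apply: measurable_funD => //; exact: measurable_funM.
pose nu : {measure set (measurableTypeR R) -> \bar R} :=
  mscale (NngNum (ltW c0)) (pushforward mu phi).
refine (@lebesgue_measure_unique R (nu mphi) _ A mA) => _ [[a b]] _ <-.
change (mu `]a, b]%classic = c%:E * mu (phi @^-1` `]a, b]))%E.
have -> : phi @^-1` `]a, b] =
    `](a - d) / c, (b - d) / c]%classic.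
  apply/seteqP; split=> x /=; rewrite /phi !in_itv/= ltr_pdivrMr// ler_pdivlMr//;
  by rewrite ltrBlDr lerBrDr mulrC.
rewrite !lebesgue_measure_itv/= !lte_fin ltr_pM2r ?invr_gt0// ltrD2r.
case: ifPn => _; last by rewrite mule0.
by rewrite -!EFinD -EFinM; congr EFin; field; rewrite gt_eqF.
Qed.

Lemma ge0_integral_affine (R : realType) (c d : R) (f : R -> \bar R) :
  0 < c -> measurable_fun [set: R] f -> (forall x, 0 <= f x)%E ->
  (\int[mu]_x f x = c%:E * \int[mu]_x f (c * x + d)%R)%E.
Proof.
move=> c0 mf f0.
pose phi := fun x : measurableTypeR R => (c * x + d : measurableTypeR R).
have mphi : measurable_fun setT phi.
  by apply: measurable_funD => //; exact: measurable_funM.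
pose nu : {measure set (measurableTypeR R) -> \bar R} :=
  mscale (NngNum (ltW c0)) (pushforward mu phi).
rewrite (@eq_measure_integral _ _ R setT (nu mphi)); last first.
  by move=> A mA _; exact: lebesgue_measure_affine.
rewrite ge0_integral_mscale//; congr (_ * _)%E.
by rewrite ge0_integral_pushforward.
Qed.

(** Tonelli's theorem and a translation in the inner integral turn the weight
    at [x] into the product of the weights at [x - t] and [t]. *)
Lemma ge0_laplace_convolution (R : realType) (l : R) (f g : R -> R) :
  measurable_fun [set: R] f -> measurable_fun [set: R] g ->
  (forall x, 0 <= f x) -> (forall x, 0 <= g x) ->
  (\int[mu]_x ((expR (- l * x))%:E * \int[mu]_t (f (x - t) * g t)%:E) =
   (\int[mu]_x (expR (- l * x) * f x)%:E) *
   (\int[mu]_t (expR (- l * t) * g t)%:E))%E.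
Proof.
move=> mf mg f0 g0.
have me : measurable_fun [set: R] (fun x : R => expR (- l * x)).
  by apply: measurableT_comp => //; exact: measurable_funM.
pose h (z : R * R) := (expR (- l * z.1) * (f (z.1 - z.2) * g z.2))%:E.
have mh : measurable_fun setT h.
  apply/measurable_EFinP; apply: measurable_funM => /=.
    by apply: (measurableT_comp me); exact: measurable_fst.
  apply: measurable_funM.
    by apply: (measurableT_comp mf); exact: measurable_funB.
  by apply: (measurableT_comp mg).
have h0 z : (0 <= h z)%E by rewrite /h lee_fin !mulr_ge0// expR_ge0.
transitivity (\int[mu]_x \int[mu]_t h (x, t))%E.
  apply: eq_integral => x _; rewrite -ge0_integralZl//.
  - apply/measurable_EFinP; apply: measurable_funM => //.
    by apply: (measurableT_comp mf); exact: measurable_funB.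
  - by move=> t _; rewrite lee_fin mulr_ge0.
rewrite fubini_tonelli//.
have mfe : measurable_fun [set: R] (fun x => (expR (- l * x) * f x)%:E).
  by apply/measurable_EFinP; exact: measurable_funM.
have fe0 x : (0 <= (expR (- l * x) * f x)%:E)%E.
  by rewrite lee_fin mulr_ge0// expR_ge0.
have mge : measurable_fun [set: R] (fun x => (expR (- l * x) * g x)%:E).
  by apply/measurable_EFinP; exact: measurable_funM.
rewrite -ge0_integralZl//; last 2 first.
- by move=> t _; rewrite lee_fin mulr_ge0// expR_ge0.
- by apply: integral_ge0 => x _; exact: fe0.
apply: eq_integral => t _.
rewrite [in RHS](@ge0_integral_affine _ 1 (- t))// mul1e -ge0_integralZr//.
- apply: eq_integral => x _; rewrite /h/= mul1r -EFinM; congr EFin.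
  have -> : - l * x = - l * (x - t) + - l * t by ring.
  by rewrite expRD; ring.
- apply: (measurableT_comp mfe) => //=.
  by apply: measurable_funD => //; exact: measurable_funM.
- by rewrite lee_fin mulr_ge0// expR_ge0.
Qed.

(** * Finiteness of Euler's integral *)

(** The antiderivative [t `^ s / s] is nonnegative, and it is smooth away from
    the possible singularity at [0]; the bound does not depend on [e]. *)
Lemma integral_powR_itv_le (R : realType) (s e : R) : 0 < s -> 0 < e -> e < 1 ->
  (\int[mu]_(t in `[e, 1%R]) (t `^ (s - 1))%:E <= (s^-1)%:E)%E.
Proof.
move=> s0 e0 e1.
have cp (p x : R) : 0 < x -> {for x, continuous (@powR R ^~ p)}.
  move=> x0; apply: differentiable_continuous; apply/derivable1_diffP.
  by apply: derivable_powR; rewrite in_itv/= x0.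
have dp (x : R) : 0 < x -> is_derive x 1 (fun t => t `^ s / s) (x `^ (s - 1)).
  move=> x0; have d := is_derive1_powR s x0.
  apply: is_derive_eq; rewrite scaler0 add0r /GRing.scale/=.
  by rewrite mulrA mulVf ?mul1r// gt_eqF.
rewrite (@continuous_FTC2 _ _ (fun t => t `^ s / s))//.
- rewrite -EFinB lee_fin powR1 mul1r gerBl divr_ge0 ?powR_ge0// ltW//.
- apply: continuous_in_subspaceT => x; rewrite inE/= in_itv/= => /andP[ex _].
  by apply: cp; exact: lt_le_trans ex.
- split.
  + move=> x; rewrite in_itv/= => /andP[ex _].
    by have := dp x (lt_trans e0 ex) => -[].
  + apply: cvg_at_right_filter; apply: cvgM; last exact: cvg_cst.
    exact: cp.
  + apply: cvg_at_left_filter; apply: cvgM; last exact: cvg_cst.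
    exact: cp.
- move=> x; rewrite in_itv/= => /andP[ex _]; rewrite derive1E.
  by have := dp x (lt_trans e0 ex) => -[].
Qed.

(** Monotone convergence along the intervals from [1 / (n + 2)] to [1]: the
    fundamental theorem of calculus is not available up to the singularity. *)
Lemma integral_powR01_lty (R : realType) (s : R) : 0 < s ->
  (\int[mu]_(t in `]0%R, 1%R]) (t `^ (s - 1))%:E < +oo)%E.
Proof.
move=> s0.
pose F n : set R := `[n.+2%:R^-1, 1]%classic.
have nF : nondecreasing_seq F.
  move=> m n mn; apply/subsetPset; apply: subset_itvr.
  by rewrite bnd_simp lef_pV2 ?posrE ?ltr0n// ler_nat.
have -> : `]0%R, 1%R]%classic = \bigcup_n F n.
  apply/seteqP; split=> x /=.
    rewrite in_itv/= => /andP[x0 x1].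
    have [n _ hn] := near_infty_natSinv_lt (PosNum x0).
    exists n => //; rewrite /F/= in_itv/= x1 andbT ltW//.
    by have := hn n.+1 (leqnSn n).
  move=> [n _]; rewrite /F/= !in_itv/= => /andP[nx ->]; rewrite andbT.
  by apply: lt_le_trans nx; rewrite invr_gt0.
have mf D : measurable_fun D (fun t : R => (t `^ (s - 1))%:E).
  by apply/measurable_EFinP; apply: measurable_funTS; exact: measurable_powR.
have cv : (\int[mu]_(t in F n) (t `^ (s - 1))%:E)%E @[n --> \oo] -->
    (\int[mu]_(t in \bigcup_n F n) (t `^ (s - 1))%:E)%E.
  apply: ge0_nondecreasing_set_cvg_integral => //.
    by move=> i; exact: measurable_itv.
    by move=> i; exact: mf.
  by move=> i x _; rewrite lee_fin powR_ge0.
rewrite -(cvg_lim _ cv)//; apply: (@le_lt_trans _ _ (s^-1)%:E); last exact: ltry.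
apply: lime_le; first by apply/cvg_ex; eexists; exact: cv.
apply: nearW => n; apply: integral_powR_itv_le => //.
by rewrite invf_lt1// ltr1n.
Qed.

(** Take the power [s] of [u <= expR u] at [u = t / (2 * s)]. *)
Lemma powR_le_expR_half (R : realType) (s t : R) : 0 < s -> 0 <= t ->
  t `^ s <= (2 * s) `^ s * expR (t / 2).
Proof.
move=> s0 t0; have s20 : 0 < 2 * s by rewrite mulr_gt0.
have -> : t / 2 = t / (2 * s) * s by field; rewrite gt_eqF.
have -> : t `^ s = (2 * s) `^ s * (t / (2 * s)) `^ s.
  rewrite -powRM ?divr_ge0// ?ltW//; congr (_ `^ _); field.
  by rewrite gt_eqF.
rewrite ler_wpM2l ?powR_ge0// expRM.
apply: ge0_ler_powR; first exact: ltW.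
- by rewrite nnegrE divr_ge0 // ltW.
- by rewrite nnegrE expR_ge0.
- by apply: le_trans (expR_ge1Dx _); rewrite lerDr.
Qed.

(** Near [0] the integrand is below [t `^ (s - 1)]; beyond [1] it is below a
    multiple of the exponential density of rate 1/2. *)
Lemma Gamma_integral_lty (R : realType) (s : R) : 0 < s ->
  (\int[mu]_(t in `]0%R, +oo[) (t `^ (s - 1) * expR (- t))%:E < +oo)%E.
Proof.
move=> s0.
pose h1 : R -> R := (fun t => t `^ (s - 1)) \_ `]0, 1].
(* The factor 2 offsets the rate 1/2 in front of the exponential density. *)
pose C : R := 2 * (2 * s) `^ s.
have mp : measurable_fun [set: R] (fun t : R => t `^ (s - 1)).
  exact: measurable_powR.
have mh1 : measurable_fun [set: R] h1.
  apply/(measurable_restrictT _ _).1; first exact: measurable_itv. exact: measurable_funTS.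
have h10 x : 0 <= h1 x.
  by rewrite /h1 patchE; case: ifP => // _; exact: powR_ge0.
have e0 x : 0 <= exponential_pdf (2^-1 : R) x.
  by apply: exponential_pdf_ge0.
have C0 : 0 <= C by rewrite /C mulr_ge0 // powR_ge0.
have me := measurable_exponential_pdf (2^-1 : R).
apply: (@le_lt_trans _ _
  (\int[mu]_(t in `]0%R, +oo[) ((h1 t)%:E + C%:E * (exponential_pdf 2^-1 t)%:E))%E).
  apply: ge0_le_integral => //.
  - by move=> x _; rewrite lee_fin mulr_ge0 ?powR_ge0 ?expR_ge0.
  - apply/measurable_EFinP; apply: measurable_funTS.
    by apply: measurable_funM => //; exact: measurableT_comp.
  - apply/measurable_EFinP; apply: measurable_funTS.
    by apply: measurable_funD => //; exact: measurable_funM.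
  - move=> x; rewrite /= in_itv/= andbT => x0.
    rewrite -EFinM -EFinD lee_fin (exponential_pdfE _ (ltW x0)) /h1 patchE.
    have [x1|x1] := leP x 1.
      rewrite mem_set/=; last by rewrite in_itv/= x0.
            apply: (@le_trans _ _ (x `^ (s - 1))).
        by rewrite ler_piMr ?powR_ge0// expR_le1// oppr_le0 ltW.
      by rewrite lerDl (mulr_ge0 C0)// mulr_ge0 ?expR_ge0// invr_ge0.
    rewrite memNset/=; last by rewrite in_itv/= x0/= => /(lt_le_trans x1); rewrite ltxx.
    rewrite -[point]/(0 : R) add0r.
    apply: (@le_trans _ _ ((2 * s) `^ s * expR (x / 2) * expR (- x))).
      rewrite ler_wpM2r ?expR_ge0//.
      apply: le_trans (powR_le_expR_half s0 (ltW x0)).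
      by apply: ler_powR; [exact: ltW|rewrite gerBl].
    rewrite -mulrA -expRD /C.
    have -> : x / 2 - x = - 2^-1 * x by field.
    by rewrite mulrACA divff// mul1r.
rewrite ge0_integralD//; last 4 first.
- by move=> x _; rewrite lee_fin.
- by apply/measurable_EFinP; apply: measurable_funTS.
- by move=> x _; rewrite mule_ge0// lee_fin.
- by apply/measurable_EFinP; apply: measurable_funTS; exact: measurable_funM.
apply: lte_add_pinfty.
  rewrite (_ : (\int[mu]_(x in _) _)%E = \int[mu]_(t in `]0%R, 1%R]) (t `^ (s - 1))%:E)%E.
    exact: integral_powR01_lty.
  rewrite integral_mkcond [RHS]integral_mkcond; apply: eq_integral => x _.
  rewrite !patchE /h1 patchE.
  have [/set_mem/= x01|x01] := boolP (x \in `]0%R, 1%R]%classic).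
    rewrite mem_set//=; move: x01; rewrite !in_itv/= => /andP[->//].
  by case: ifP.
rewrite ge0_integralZl//; last first.
- by move=> x _; rewrite lee_fin.
- by apply/measurable_EFinP; apply: measurable_funTS.
apply: lte_mul_pinfty => //.
apply: (@le_lt_trans _ _ (\int[mu]_x (exponential_pdf (2^-1 : R) x)%:E)%E).
  apply: ge0_subset_integral => //; first exact/measurable_EFinP.
  by move=> x _; rewrite lee_fin.
by rewrite integral_exponential_pdf ?ltry// invr_gt0.
Qed.

(** * Truncated powers and the Beta integral *)

(** The value at [0] is [0] for every [s].  With this choice the convolution of
    two truncated powers vanishes on the closed negative half-line, exactly as
    a truncated power does, and [truncated_powR_convolution] can be compared
    with a truncated power at every point rather than almost everywhere. *)
Definition truncated_powR (R : realType) (s t : R) : R :=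
  if 0 < t then t `^ (s - 1) else 0.

Lemma truncated_powR_ge0 (R : realType) (s t : R) : 0 <= truncated_powR s t.
Proof. by rewrite /truncated_powR; case: ifP => // _; exact: powR_ge0. Qed.

Lemma measurable_truncated_powR (R : realType) (s : R) :
  measurable_fun [set: R] (truncated_powR s).
Proof.
apply: measurable_fun_ifT => //.
exact: measurable_fun_ltr.
Qed.

Lemma truncated_powR_scale (R : realType) (s c t : R) : 0 < c ->
  truncated_powR s (c * t) = c `^ (s - 1) * truncated_powR s t.
Proof.
move=> c0; rewrite /truncated_powR pmulr_rgt0//; case: ifPn => t0; last by rewrite mulr0.
by rewrite powRM// ltW.
Qed.

Lemma integral_truncated_powR_Gamma (R : realType) (s : R) : 0 < s ->
  (\int[mu]_t (expR (- 1 * t) * truncated_powR s t)%:E = (Gamma s)%:E)%E.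
Proof.
move=> s0; rewrite /Gamma /Rintegral fineK; last first.
  rewrite ge0_fin_numE. exact: (Gamma_integral_lty s0).
  by apply: integral_ge0 => x _; rewrite lee_fin mulr_ge0 ?powR_ge0 ?expR_ge0.
rewrite [RHS]integral_mkcond; apply: eq_integral => t _; rewrite patchE /truncated_powR.
have [t0|t0] := ltP 0 t.
  by rewrite mem_set/= ?in_itv/= ?t0// mulN1r mulrC.
by rewrite memNset/= ?mulr0// in_itv/= andbT; apply/negP; rewrite -leNgt.
Qed.

(** The scaling [t := t / l] reduces the transform at [l] to Euler's
    integral. *)
Lemma laplace_truncated_powR (R : realType) (s l : R) : 0 < s -> 0 < l ->
  (\int[mu]_t (expR (- l * t) * truncated_powR s t)%:E = (l `^ (- s) * Gamma s)%:E)%E.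
Proof.
move=> s0 l0; have me : measurable_fun [set: R] (fun x : R => expR (- l * x)).
  by apply: measurableT_comp => //; exact: measurable_funM.
have m1 : measurable_fun [set: R] (fun x : R => expR (- 1 * x)).
  by apply: measurableT_comp => //; exact: measurable_funM.
rewrite (@ge0_integral_affine _ l^-1 0) ?invr_gt0//; last 2 first.
- by apply/measurable_EFinP/measurable_funM => //; exact: measurable_truncated_powR.
- by move=> x; rewrite lee_fin mulr_ge0 ?expR_ge0 ?truncated_powR_ge0.
under eq_integral => t _.
  rewrite addr0 truncated_powR_scale ?invr_gt0//.
  rewrite (_ : - l * _ = - 1 * t); last by field; rewrite gt_eqF.
  rewrite mulrCA EFinM; over.
rewrite ge0_integralZl//; last 3 first.
- by apply/measurable_EFinP/measurable_funM => //; exact: measurable_truncated_powR.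
- by move=> x _; rewrite lee_fin mulr_ge0 ?expR_ge0 ?truncated_powR_ge0.
- by rewrite lee_fin powR_ge0.
rewrite integral_truncated_powR_Gamma// -!EFinM mulrA; congr (_ * _)%:E.
rewrite -(powR_inv1 (ltW l0)) -powRrM -powRD ?(gt_eqF l0) ?implybT//.
by congr (_ `^ _); ring.
Qed.

(** On the interval from [A] to [A + 1], of length one, the integrand of Euler's
    integral is at least the left-hand side.  With [A] fixed and [s] growing
    this shows that Gamma beats every geometric sequence, which is all that the
    convergence of the Mittag-Leffler series requires; with [A = 1] it shows
    that Gamma is positive. *)
Lemma Gamma_ge (R : realType) (s A : R) : 0 < s -> 1 <= A ->
  A `^ s * (expR (- (A + 1)) / (A + 1)) <= Gamma s.
Proof.
move=> s0 A1; have A0 : 0 < A by exact: lt_le_trans A1.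
have A10 : 0 < A + 1 by rewrite addr_gt0.
rewrite -lee_fin -integral_truncated_powR_Gamma//.
set K := (A `^ s * _).
have K0 : 0 <= K by rewrite /K mulr_ge0 ?powR_ge0// divr_ge0 ?expR_ge0// ltW.
have m1 : measurable_fun [set: R] (fun x : R => expR (- 1 * x)).
  by apply: measurableT_comp => //; exact: measurable_funM.
have mf : measurable_fun [set: R] (fun t => (expR (- 1 * t) * truncated_powR s t)%:E).
  by apply/measurable_EFinP/measurable_funM => //; exact: measurable_truncated_powR.
have f0 (t : R) : (0 <= (expR (- 1 * t) * truncated_powR s t)%:E)%E.
  by rewrite lee_fin mulr_ge0 ?expR_ge0 ?truncated_powR_ge0.
apply: (@le_trans _ _ (\int[mu]_(t in `[A, (A + 1)%R]) (cst K%:E) t)%E).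
  rewrite integral_cst//= lebesgue_measure_itv/= lte_fin ltrDl ltr01.
  by rewrite -EFinB addrAC subrr add0r mule1.
apply: (@le_trans _ _
    (\int[mu]_(t in `[A, (A + 1)%R]) (expR (- 1 * t) * truncated_powR s t)%:E)%E); last first.
  by apply: ge0_subset_integral.
apply: ge0_le_integral => //; first exact: measurable_funTS.
move=> t; rewrite /= in_itv/= => /andP[At tA].
have t0 : 0 < t by exact: lt_le_trans At.
rewrite lee_fin /truncated_powR t0 /K powRB ?(gt_eqF t0) ?implybT// powRr1 ?(ltW t0)//.
rewrite mulrCA; apply: ler_pM; first exact: expR_ge0.
- by rewrite divr_ge0 ?powR_ge0 ?(ltW A10).
- by rewrite ler_expR mulN1r lerN2.
apply: ler_pM; rewrite ?invr_ge0 ?(ltW A10) ?lef_pV2 ?posrE ?powR_ge0//.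
by apply: ge0_ler_powR; rewrite ?nnegrE// ltW.
Qed.

Lemma Gamma_gt0 (R : realType) (s : R) : 0 < s -> 0 < Gamma s.
Proof.
move=> s0; apply: lt_le_trans (Gamma_ge s0 (lexx 1)).
by rewrite powR1 mul1r divr_gt0 ?expR_gt0.
Qed.

(** By scaling, the convolution at [x] is [x `^ (a + b - 1)] times its value [B]
    at [1].  Its Laplace transform at [1] is therefore [Gamma (a + b) * B], and
    it is also the product [Gamma a * Gamma b] of the two transforms. *)
Lemma truncated_powR_convolution (R : realType) (a b x : R) : 0 < a -> 0 < b -> 0 < x ->
  (\int[mu]_t (truncated_powR a (x - t) * truncated_powR b t)%:E =
   (x `^ (a + b - 1) * (Gamma a * Gamma b / Gamma (a + b)))%:E)%E.
Proof.
move=> a0 b0.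
have mpp y : measurable_fun [set: R] (fun t => (truncated_powR a (y - t) * truncated_powR b t)%:E).
  apply/measurable_EFinP/measurable_funM; last exact: measurable_truncated_powR.
  by apply: (measurableT_comp (measurable_truncated_powR a)); exact: measurable_funB.
have pp0 y t : (0 <= (truncated_powR a (y - t) * truncated_powR b t)%:E)%E.
  by rewrite lee_fin mulr_ge0 ?truncated_powR_ge0.
pose B := (\int[mu]_t (truncated_powR a (1 - t) * truncated_powR b t)%:E)%E.
have B0 : (0 <= B)%E by apply: integral_ge0.
have conv y : 0 < y ->
    (\int[mu]_t (truncated_powR a (y - t) * truncated_powR b t)%:E = (y `^ (a + b - 1))%:E * B)%E.
  move=> y0; rewrite (@ge0_integral_affine _ y 0 _ y0 (mpp y) (pp0 y)).
  have k0 : (0 <= (y `^ (a - 1) * y `^ (b - 1))%:E)%E.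
    by rewrite lee_fin mulr_ge0 ?powR_ge0.
  transitivity (y%:E * ((y `^ (a - 1) * y `^ (b - 1))%:E * B))%E.
    congr (_ * _)%E.
    rewrite -(@ge0_integralZl _ _ _ mu _ measurableT _ (mpp 1) _
      (fun t _ => pp0 1 t) k0).
    apply: eq_integral => t _.
    rewrite addr0 (_ : y - y * t = y * (1 - t)); last by ring.
    by rewrite (truncated_powR_scale _ _ y0) (truncated_powR_scale _ _ y0) mulrACA EFinM.
  rewrite muleA -EFinM -[in X in (X * _)%:E](powRr1 (ltW y0)).
  rewrite -!powRD ?(gt_eqF y0) ?implybT//.
  by congr ((_ `^ _)%:E * _)%E; ring.
have conv0 z : z <= 0 -> (\int[mu]_t (truncated_powR a (z - t) * truncated_powR b t)%:E = 0)%E.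
  move=> z0; apply: integral0_eq => t _; rewrite /truncated_powR.
  have [t0|] := ltP 0 t; last by rewrite mulr0.
  by rewrite subr_gt0 ltNge (le_trans z0 (ltW t0))/= mul0r.
have ab0 : 0 < a + b by rewrite addr_gt0.
have mG : measurable_fun [set: R] (fun t => (expR (- 1 * t) * truncated_powR (a + b) t)%:E).
  apply/measurable_EFinP/measurable_funM; last exact: measurable_truncated_powR.
  by apply: measurableT_comp => //; exact: measurable_funM.
have G0 t : (0 <= (expR (- 1 * t) * truncated_powR (a + b) t)%:E)%E.
  by rewrite lee_fin mulr_ge0 ?expR_ge0 ?truncated_powR_ge0.
have : (Gamma a * Gamma b)%:E = ((Gamma (a + b))%:E * B)%E.
  rewrite EFinM -(integral_truncated_powR_Gamma a0) -(integral_truncated_powR_Gamma b0).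
  rewrite -(integral_truncated_powR_Gamma ab0) -(ge0_laplace_convolution 1
    (measurable_truncated_powR a) (measurable_truncated_powR b) (@truncated_powR_ge0 _ a) (@truncated_powR_ge0 _ b)).
  rewrite -(@ge0_integralZr _ _ _ mu _ measurableT _ mG B (fun t _ => G0 t) B0).
  apply: eq_integral => y _; have [y0|y0] := ltP 0 y.
    rewrite (conv y y0) (_ : truncated_powR (a + b) y = y `^ (a + b - 1)).
      by rewrite EFinM muleA.
    by rewrite /truncated_powR y0.
  rewrite (conv0 y y0) mule0 (_ : truncated_powR (a + b) y = 0) ?mulr0 ?mul0e//.
  by rewrite /truncated_powR ltNge y0.
move=> GB x0; rewrite conv// EFinM; congr (_ * _)%E.
have Gab0 := Gamma_gt0 ab0.
by rewrite mulrC EFinM GB muleA -EFinM mulVf ?gt_eqF// mul1e.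
Qed.

Lemma beta_integral (R : realType) (a b x : R) : 0 < a -> 0 < b -> 0 < x ->
  (\int[mu]_(t in `[0%R, x]) ((x - t) `^ (a - 1) * t `^ (b - 1))%:E =
   (x `^ (a + b - 1) * (Gamma a * Gamma b / Gamma (a + b)))%:E)%E.
Proof.
move=> a0 b0 x0; rewrite -truncated_powR_convolution//.
have mk : measurable_fun [set: R]
    (fun t => ((x - t) `^ (a - 1) * t `^ (b - 1))%:E).
  apply/measurable_EFinP/measurable_funM; last exact: measurable_powR.
  apply: (measurableT_comp (measurable_powR _)); exact: measurable_funB.
rewrite integral_itv_bndoo; last exact: measurable_funTS.
rewrite integral_mkcond; apply: eq_integral => t _; rewrite patchE /truncated_powR.
rewrite subr_gt0.
have [t0|t0] := ltP 0 t; last first.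
  by rewrite mulr0 memNset//= in_itv/= ltNge t0.
have [tx|tx] := ltP t x; first by rewrite mem_set//= in_itv/= t0.
by rewrite mul0r memNset//= in_itv/= t0/= ltNge tx.
Qed.

Lemma integrable_beta (R : realType) (a b x : R) : 0 < a -> 0 < b -> 0 < x ->
  lebesgue_measure.-integrable `[0, x]
    (EFin \o (fun t : R => (x - t) `^ (a - 1) * t `^ (b - 1))).
Proof.
move=> a0 b0 x0; apply/integrableP; split.
  apply: measurable_funTS; apply/measurable_EFinP/measurable_funM.
    by apply: (measurableT_comp (measurable_powR _)); exact: measurable_funB.
  exact: measurable_powR.
under eq_integral => t _.
  rewrite /= ger0_norm; last by rewrite mulr_ge0 ?powR_ge0.
  over.
by rewrite beta_integral// ltry.
Qed.

(** * Uniqueness: a weighted L1 estimate *)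

Lemma lebesgue_aeS (R : realType) (P Q : R -> Prop) :
  (forall x, P x -> Q x) ->
  {ae mu, forall x : R, P x} -> {ae mu, forall x : R, Q x}.
Proof. exact: (@filterS _ _ (ae_filter_ringOfSetsType (@lebesgue_measure R))). Qed.

Lemma lebesgue_aeI (R : realType) (P Q : R -> Prop) :
  {ae mu, forall x : R, P x} -> {ae mu, forall x : R, Q x} ->
  {ae mu, forall x : R, P x /\ Q x}.
Proof. exact: (@filterI _ _ (ae_filter_ringOfSetsType (@lebesgue_measure R))). Qed.

(** Let [I] be the integral of [expR (- l * x) * g x].  Integrating the
    hypothesis against the weight bounds [I] by [c * Gamma a * l `^ (- a) * I],
    the Laplace transform of the truncated power being [Gamma a * l `^ (- a)].
    For large [l] the factor is less than one, and [I] is finite, so that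
    [I = 0]. *)
Lemma convolution_gronwall (R : realType) (a c : R) (g : R -> R) :
  0 < a -> 0 <= c -> measurable_fun [set: R] g -> (forall x, 0 <= g x) ->
  (\int[mu]_x (g x)%:E < +oo)%E -> (forall x, x <= 0 -> g x = 0) ->
  {ae mu, forall x : R,
    ((g x)%:E <= c%:E * \int[mu]_t (truncated_powR a (x - t) * g t)%:E)%E} ->
  {ae mu, forall x : R, g x = 0}.
Proof.
move=> a0 c0 mg g0 gfin gneg gle.
have G0 := Gamma_gt0 a0.
(* [l] is chosen so that [c * Gamma a * l `^ (- a)] is [c * Gamma a / K],
   which is less than one. *)
pose K := c * Gamma a + 1.
have K0 : 0 < K by rewrite ltr_pwDr// mulr_ge0// ltW.
pose l := K `^ a^-1.
have l0 : 0 < l by exact: powR_gt0.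
have lK : l `^ (- a) = K^-1.
  by rewrite /l -powRrM mulrN mulVf ?gt_eqF// powR_inv1// ltW.
have me : measurable_fun [set: R] (fun x : R => expR (- l * x)).
  by apply: measurableT_comp => //; exact: measurable_funM.
have meg : measurable_fun [set: R] (fun x => (expR (- l * x) * g x)%:E).
  by apply/measurable_EFinP; exact: measurable_funM.
have eg0 x : (0 <= (expR (- l * x) * g x)%:E)%E.
  by rewrite lee_fin mulr_ge0 ?expR_ge0.
pose I := (\int[mu]_x (expR (- l * x) * g x)%:E)%E.
have I0 : (0 <= I)%E by apply: integral_ge0.
have Ifin : I \is a fin_num.
  rewrite ge0_fin_numE//; apply: le_lt_trans gfin; apply: ge0_le_integral => //.
  - by apply/measurable_EFinP.
  - move=> x _; rewrite lee_fin; have [x0|x0] := leP x 0.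
      by rewrite gneg// mulr0.
    by rewrite ler_piMl// expR_le1// mulNr oppr_le0 mulr_ge0// ltW.
pose conv x := (\int[mu]_t (truncated_powR a (x - t) * g t)%:E)%E.
have mconv : measurable_fun [set: R] conv.
  pose h (z : R * R) := (truncated_powR a (z.1 - z.2) * g z.2)%:E.
  have mh : measurable_fun [set: R * R] h.
    apply/measurable_EFinP; apply: measurable_funM => /=.
      by apply: (measurableT_comp (measurable_truncated_powR a)); exact: measurable_funB.
    exact: (measurableT_comp mg).
  have h0 z : (0 <= h z)%E by rewrite lee_fin mulr_ge0 ?truncated_powR_ge0.
  exact: (measurable_fun_fubini_tonelli_F (m2 := mu) h mh h0).
have conv0 x : (0 <= conv x)%E.
  by apply: integral_ge0 => t _; rewrite lee_fin mulr_ge0 ?truncated_powR_ge0.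
have Ile : (I <= c%:E * ((l `^ (- a) * Gamma a)%:E * I))%E.
  rewrite -laplace_truncated_powR// -ge0_laplace_convolution//; last 2 first.
  - exact: measurable_truncated_powR.
  - exact: truncated_powR_ge0.
  have mec : measurable_fun [set: R] (fun x => (expR (- l * x))%:E * conv x)%E.
    by apply: emeasurable_funM => //; exact/measurable_EFinP.
  have ec0 x : (0 <= (expR (- l * x))%:E * conv x)%E.
    by rewrite mule_ge0// lee_fin expR_ge0.
  rewrite -ge0_integralZl//.
  apply: ae_ge0_le_integral => //.
  - by move=> x _; rewrite mule_ge0// lee_fin.
  - exact: measurable_funeM.
  - apply: (lebesgue_aeS _ gle) => x xle _.
    by rewrite muleCA EFinM lee_pmul2l// lte_fin expR_gt0.
have {Ile} : (fine I)%:E = 0%E.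
  move: Ile; rewrite -(fineK Ifin) -!EFinM lee_fin lK => Ile.
  have := fine_ge0 I0; move: (fine I) Ile => i Ile i0.
  congr EFin; apply/eqP; rewrite eq_le i0 andbT.
  have : K * i <= c * Gamma a * i.
    rewrite -(ler_pM2l K0) in Ile; apply: le_trans Ile _.
    by rewrite le_eqVlt; apply/orP; left; apply/eqP; field; rewrite gt_eqF.
  by rewrite /K mulrDl mul1r gerDl.
rewrite fineK// => Ieq0.
have /(ae_eq_integral_abs mu measurableT meg) :
    (\int[mu]_x `|(expR (- l * x) * g x)%:E| = 0)%E.
  by rewrite -Ieq0; apply: eq_integral => x _; rewrite gee0_abs.
apply: lebesgue_aeS => x /(_ Logic.I)/eqP; rewrite eqe mulf_eq0 gt_eqF ?expR_gt0//=.
by move=> /eqP.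
Qed.

(** Cut [D] off outside each bounded interval, apply [convolution_gronwall] to
    the absolute value, and take the union of the countably many null sets.
    The cutoff keeps the inequality because the fractional integral at [x]
    only involves the values of [D] before [x]. *)
Lemma fractional_gronwall (R : realType) (a c : R) (D : R -> R) :
  0 < a -> a < 1 -> 0 <= c -> integrable_on_finite_intervals D ->
  {ae mu, forall x : R, 0 < x ->
    (`|D x|%:E <= c%:E * \int[mu]_(t in `[0%R, x]) `|RL_kernel a D x t|%:E)%E} ->
  {ae mu, forall x : R, 0 < x -> D x = 0}.
Proof.
move=> a0 a1 c0 iD Dle.
have mD n : measurable_fun (`]0, n.+1%:R]%classic : set R) D.
  have /integrableP[+ _] := iD n.+1%:R (ltr0Sn R n).
  move=> /measurable_EFinP mm; apply: (measurable_funS _ _ mm) => //.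
  by apply: subset_itvr; rewrite bnd_simp.
(* [0] is excluded because the inequality for [D] is only given at positive
   points. *)
pose g n : R -> R := (fun t => `|D t|) \_ `]0, n.+1%:R].
have gE n x : 0 < x -> x <= n.+1%:R -> g n x = `|D x|.
  by move=> x0 xn; rewrite /g patchE mem_set//= in_itv/= x0.
have gN n x : ~~ (0 < x <= n.+1%:R) -> g n x = 0.
  by move=> xn; rewrite /g patchE memNset//= in_itv/=; exact/negP.
suff : {ae mu, forall x n, g n x = 0}.
  apply: lebesgue_aeS => x gx x0.
  have := gx (Num.truncn x); rewrite gE//; last exact/ltW/truncnS_gt.
  by move/eqP; rewrite normr_eq0 => /eqP.
apply/ae_foralln => n.
apply: (@convolution_gronwall _ a c) => //.
- apply/(measurable_restrictT _ _).1; first exact: measurable_itv.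
  exact: measurableT_comp.
- by move=> x; rewrite /g patchE; case: ifP.
- have /integrableP[_] := iD n.+1%:R (ltr0Sn R n).
  apply: le_lt_trans; rewrite [leRHS]integral_mkcond.
  rewrite le_eqVlt; apply/orP; left; apply/eqP.
  have mDc : measurable_fun (`[0, n.+1%:R]%classic : set R)
      (fun t => (`|D t|)%:E).
    have /integrableP[+ _] := iD n.+1%:R (ltr0Sn R n).
    by move=> /measurable_EFinP mD0; apply/measurable_EFinP/measurableT_comp.
  rewrite -[RHS]integral_mkcond /= -integral_itv_obnd_cbnd; last first.
    by apply: (measurable_funS _ _ mDc) => //; apply: subset_itvr; rewrite bnd_simp.
  rewrite [RHS]integral_mkcond; apply: eq_integral => t _.
  by rewrite /g !patchE; case: ifP.
- by move=> x x0; rewrite gN// ltNge x0.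
apply: (lebesgue_aeS _ Dle) => x Dx.
have cI0 : (0 <= c%:E * \int[mu]_t (truncated_powR a (x - t) * g n t)%:E)%E.
  rewrite mule_ge0 ?lee_fin//; apply: integral_ge0 => t _.
  rewrite lee_fin mulr_ge0 ?truncated_powR_ge0//.
  by rewrite /g patchE; case: ifP.
have [/andP[x0 xn]|xn] := boolP (0 < x <= n.+1%:R); last by rewrite gN.
rewrite gE//; apply: le_trans (Dx x0) _; rewrite lee_wpmul2l ?lee_fin//.
rewrite -integral_itv_obnd_cbnd; last first.
  apply/measurable_EFinP; apply: measurableT_comp => //.
  apply: measurable_funM.
    apply: measurable_funTS; apply: (measurableT_comp (measurable_powR _)).
    exact: measurable_funB.
  by apply: (measurable_funS _ _ (mD n)) => //; apply: subset_itvl; rewrite bnd_simp.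
rewrite le_eqVlt; apply/orP; left; apply/eqP.
rewrite integral_mkcond; apply: eq_integral => t _; rewrite patchE.
have [t0|t0] := ltP 0 t; last first.
  rewrite memNset/= ?in_itv/= ?gN ?mulr0// ?ltNge ?t0//.
have [tx|tx] := leP t x; last first.
  rewrite memNset/= ?in_itv/= ?t0/= ?leNgt ?tx// /truncated_powR subr_gt0 ltNge ltW//.
  by rewrite mul0r.
rewrite mem_set/= ?in_itv/= ?t0// gE//; last exact: le_trans xn.
rewrite /RL_kernel normrM ger0_norm ?powR_ge0// /truncated_powR subr_gt0.
move: tx; rewrite le_eqVlt => /predU1P[->|->//].
(* At [t = x] both kernels vanish: [0 `^ (a - 1) = 0] because [a != 1]. *)
by rewrite ltxx subrr powR0// subr_eq0 lt_eqF.
Qed.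

(** * The Mittag-Leffler series *)

Definition ml_coef (R : realType) (d a b : R) (k : nat) : R :=
  pochhammer d k / (k`!%:R * Gamma (a * k%:R + b)).

Lemma mittag_lefflerE (R : realType) (d a b z : R) :
  mittag_leffler d a b z = limn (series (fun k => ml_coef d a b k * z ^+ k)).
Proof.
congr (limn (series _)); apply/funext => k.
by rewrite /ml_coef mulrAC.
Qed.

Lemma pochhammerS (R : realType) (d : R) (k : nat) :
  pochhammer d k.+1 = pochhammer d k * (d + k%:R).
Proof. by rewrite /pochhammer big_ord_recr. Qed.

Lemma pochhammerSl (R : realType) (d : R) (k : nat) :
  pochhammer (d - 1) k.+1 = (d - 1) * pochhammer d k.
Proof.
rewrite /pochhammer big_ord_recl/= addr0; congr (_ * _).
by apply: eq_bigr => i _; rewrite -natr1; ring.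
Qed.

(** The identity that makes the equation hold: lowering the parameter by one
    changes the coefficient of order [k.+1] by a multiple of the one of order
    [k], the shift that fractional integration performs on powers. *)
Lemma pochhammerB1 (R : realType) (d : R) (k : nat) :
  pochhammer d k.+1 - pochhammer (d - 1) k.+1 = k.+1%:R * pochhammer d k.
Proof. by rewrite pochhammerS pochhammerSl -natr1; ring. Qed.

Lemma norm_pochhammer_le (R : realType) (d : R) (k : nat) :
  `|pochhammer d k| <= (`|d| + 1) ^+ k * k`!%:R.
Proof.
elim: k => [|k IH]; first by rewrite /pochhammer big_ord0 normr1 expr0 mul1r.
rewrite pochhammerS normrM factS natrM exprSr [k.+1%:R * _]mulrC mulrACA.
apply: ler_pM => //; apply: le_trans (ler_normD _ _) _.
rewrite normr_nat -natr1.
by have := ler0n R k; have := normr_ge0 d; nra.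
Qed.

(** The Pochhammer quotient grows at most like the powers of [`|d| + 1], while
    by [Gamma_ge] the Gamma factor outgrows the powers of [q], twice the
    product of the two bases to be absorbed. *)
Lemma ml_coef_geometric (R : realType) (d a b z : R) :
  0 < a -> 0 < b -> 0 <= z ->
  exists2 K, 0 <= K & forall k, `|ml_coef d a b k| * z ^+ k <= K * 2^-1 ^+ k.
Proof.
move=> a0 b0 z0.
have d1 : 1 <= `|d| + 1 by rewrite lerDr.
have z1 : 1 <= z + 1 by rewrite lerDr.
pose q := 2 * ((`|d| + 1) * (z + 1)).
have q1 : 1 <= q by rewrite /q; nra.
have q0 : 0 < q by exact: lt_le_trans q1.
(* With this [A], [Gamma_ge] bounds [Gamma (a * k%:R + b)] below by a
   multiple of [q ^+ k]. *)
pose A := q `^ a^-1.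
have A1 : 1 <= A.
  by have := ler_powR q1 (_ : 0 <= a^-1); rewrite powRr0; apply; rewrite invr_ge0 ltW.
have A0 : 0 < A by exact: lt_le_trans A1.
have Aa : A `^ a = q by rewrite /A -powRrM mulVf ?gt_eqF// powRr1 ?(ltW q0).
pose k0 := expR (- (A + 1)) / (A + 1).
have k00 : 0 < k0 by rewrite divr_gt0 ?expR_gt0// addr_gt0.
exists k0^-1; first by rewrite invr_ge0 ltW.
move=> k; have s0 : 0 < a * k%:R + b.
  by rewrite ltr_wpDl// mulr_ge0// ltW.
have G0 := Gamma_gt0 s0.
have qG : q ^+ k <= k0^-1 * Gamma (a * k%:R + b).
  rewrite mulrC ler_pdivlMr//; apply: le_trans (Gamma_ge s0 A1).
  rewrite -/k0 ler_pM2r// powRD; last by rewrite gt_eqF ?implybT.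
  rewrite powRrM Aa.
  rewrite powR_mulrn ?(ltW q0)// ler_peMr ?exprn_ge0 ?(ltW q0)//.
  by have := ler_powR A1 (ltW b0); rewrite powRr0.
have f0 : 0 < (k`!%:R : R) by rewrite ltr0n fact_gt0.
rewrite /ml_coef normrM normfV normrM (gtr0_norm G0) normr_nat.
rewrite mulrAC ler_pdivrMr ?mulr_gt0//.
rewrite (_ : k0^-1 * 2^-1 ^+ k * (k`!%:R * Gamma (a * k%:R + b)) =
  (k0^-1 * Gamma (a * k%:R + b)) * (2^-1 ^+ k * k`!%:R)); last by ring.
apply: (@le_trans _ _ (q ^+ k * (2^-1 ^+ k * k`!%:R))); last first.
  by rewrite ler_wpM2r// mulr_ge0// ?exprn_ge0.
rewrite mulrA -exprMn /q.
rewrite (_ : 2 * ((`|d| + 1) * (z + 1)) * 2^-1 = (`|d| + 1) * (z + 1)); last by field.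
rewrite exprMn mulrAC; apply: ler_pM; rewrite ?exprn_ge0//.
  exact: norm_pochhammer_le.
by rewrite lerXn2r// ?nnegrE ?addr_ge0// lerDl.
Qed.

Lemma ml_abs_cvg (R : realType) (d a b z : R) : 0 < a -> 0 < b -> 0 <= z ->
  cvgn (series (fun k => `|ml_coef d a b k| * z ^+ k)).
Proof.
move=> a0 b0 z0; have [K K0 hK] := ml_coef_geometric d a0 b0 z0.
apply: (@series_le_cvg _ _ (geometric K 2^-1)) => //.
- by move=> k; rewrite mulr_ge0 ?exprn_ge0.
- by move=> k; rewrite /= mulr_ge0 ?exprn_ge0.
- apply: is_cvg_geometric_series.
  by rewrite ger0_norm// invf_lt1// ltr1n.
Qed.

Lemma ml_cvg (R : realType) (d a b z : R) : 0 < a -> 0 < b ->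
  cvgn (series (fun k => ml_coef d a b k * z ^+ k)).
Proof.
move=> a0 b0; apply: (@normed_cvg _ R^o).
have := @ml_abs_cvg _ d a b `|z| a0 b0 (normr_ge0 z).
suff -> : (fun k => `|ml_coef d a b k| * `|z| ^+ k) =
    (fun k => `|ml_coef d a b k * z ^+ k|) by [].
by apply/funext => k; rewrite [RHS]normrM normrX.
Qed.

(** A bound uniform in the order of the partial sum and in the argument, which
    makes the partial sums of a profile dominated on bounded intervals. *)
Lemma ml_partial_sum_bounded (R : realType) (d a b z : R) :
  0 < a -> 0 < b -> 0 <= z -> exists2 M : R, 0 <= M &
  forall (w : R) n, `|w| <= z ->
    `|series (fun k => ml_coef d a b k * w ^+ k) n| <= M.
Proof.
move=> a0 b0 z0; have cv := @ml_abs_cvg R d a b z a0 b0 z0.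
have nd : nondecreasing_seq (series (fun k => `|ml_coef d a b k| * z ^+ k)).
  by apply: nondecreasing_series => k _ _; rewrite mulr_ge0 ?exprn_ge0.
exists (limn (series (fun k => `|ml_coef d a b k| * z ^+ k))).
  by have := nondecreasing_cvgn_le nd cv 0%N; rewrite /series/= big_nil.
move=> w n wz; apply: le_trans (nondecreasing_cvgn_le nd cv n).
rewrite /series/=; apply: le_trans (ler_norm_sum _ _ _) _.
apply: ler_sum => k _; rewrite normrM normrX ler_wpM2l//.
by rewrite lerXn2r ?nnegrE.
Qed.

(** The terms of order zero cancel; [pochhammerB1] handles the others. *)
Lemma ml_series_shift (R : realType) (d a b z : R) (n : nat) :
  series (fun k => ml_coef d a b k * z ^+ k) n.+1 -
  series (fun k => ml_coef (d - 1) a b k * z ^+ k) n.+1 =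
  z * \sum_(0 <= k < n) pochhammer d k / (k`!%:R * Gamma (a + (a * k%:R + b)))
    * z ^+ k.
Proof.
have p0 e : pochhammer e 0 = 1 :> R by rewrite /pochhammer big_ord0.
rewrite /series/= !big_nat_recl//= /ml_coef !p0.
rewrite opprD addrACA subrr add0r -sumrB mulr_sumr; apply: eq_bigr => k _.
rewrite -mulrBl -mulrBl pochhammerB1 exprS factS natrM.
rewrite (_ : a * k.+1%:R + b = a + (a * k%:R + b)); last by rewrite -natr1; ring.
set G := Gamma _.
have k1 : (k.+1%:R : R) != 0 by rewrite pnatr_eq0.
by rewrite -[k.+1%:R * _ * G]mulrA -mulf_div divff// mul1r mulrCA.
Qed.

(** * The fractional integral of a Mittag-Leffler function *)

(** Up to the constant [C] this is the Prabhakar kernel.  The solution and the free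
    term of the equation are the profiles with parameters [d] and
    [d - 1]. *)
Definition ml_profile (R : realType) (C z d a b x : R) : R :=
  C * x `^ (b - 1) * mittag_leffler d a b (z * x `^ a).

Definition ml_partial (R : realType) (C z d a b : R) (n : nat) (x : R) : R :=
  C * x `^ (b - 1) * series (fun k => ml_coef d a b k * (z * x `^ a) ^+ k) n.

Lemma ml_partial_cvg (R : realType) (C z d a b x : R) : 0 < a -> 0 < b ->
  ml_partial C z d a b n x @[n --> \oo] --> ml_profile C z d a b x.
Proof.
move=> a0 b0; rewrite /ml_profile mittag_lefflerE; apply: cvgMr.
exact: ml_cvg.
Qed.

Lemma measurable_ml_partial (R : realType) (C z d a b : R) (n : nat) :
  measurable_fun [set: R] (ml_partial C z d a b n).
Proof.
apply: measurable_funM.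
  by apply: measurable_funM => //; exact: measurable_powR.
rewrite /series /=; apply: measurable_sum => k.
apply: measurable_funM => //; apply: measurable_funX.
by apply: measurable_funM => //; exact: measurable_powR.
Qed.

Lemma measurable_ml_profile (R : realType) (C z d a b : R) : 0 < a -> 0 < b ->
  measurable_fun [set: R] (ml_profile C z d a b).
Proof.
move=> a0 b0; apply: (measurable_fun_cvg (h := ml_partial C z d a b)).
  by move=> n; exact: measurable_ml_partial.
by move=> x _; exact: ml_partial_cvg.
Qed.

Lemma ml_partial_bounded (R : realType) (C z d a b x : R) :
  0 < a -> 0 < b -> 0 < x -> exists M : R, forall n t, 0 <= t <= x ->
    `|ml_partial C z d a b n t| <= M * t `^ (b - 1).
Proof.
move=> a0 b0 x0.
have z0 : 0 <= `|z| * x `^ a by rewrite mulr_ge0 ?powR_ge0.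
have [M M0 hM] := ml_partial_sum_bounded d a0 b0 z0.
exists (`|C| * M) => n t /andP[t0 tx].
rewrite /ml_partial !normrM (ger0_norm (powR_ge0 t _)) [leRHS]mulrAC.
rewrite ler_wpM2l ?mulr_ge0 ?powR_ge0//; apply: hM.
rewrite normrM (ger0_norm (powR_ge0 t _)) ler_wpM2l//.
by apply: ge0_ler_powR; rewrite ?nnegrE ?(ltW a0) ?(ltW x0).
Qed.

Lemma ml_profile_bounded (R : realType) (C z d a b x : R) :
  0 < a -> 0 < b -> 0 < x -> exists M : R, forall t, 0 <= t <= x ->
    `|ml_profile C z d a b t| <= M * t `^ (b - 1).
Proof.
move=> a0 b0 x0; have [M hM] := ml_partial_bounded C z d a0 b0 x0.
exists M => t tx; have cv := @ml_partial_cvg R C z d a b t a0 b0.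
have cvn : `|ml_partial C z d a b n t| @[n --> \oo] --> `|ml_profile C z d a b t|.
  exact: cvg_norm.
rewrite -(cvg_lim (@Rhausdorff R) cvn); apply: limr_le.
  by apply/cvg_ex; eexists; exact: cvn.
by apply: nearW => n; exact: hM.
Qed.

(** The kernel is dominated by a multiple of the Beta integrand. *)
Lemma RL_exists_bounded (R : realType) (a b x M : R) (N : R -> R) :
  0 < a -> 0 < b -> 0 < x -> measurable_fun [set: R] N ->
  (forall t, 0 <= t <= x -> `|N t| <= M * t `^ (b - 1)) ->
  RL_exists a N x.
Proof.
move=> a0 b0 x0 mN hN; rewrite /RL_exists.
have ib : lebesgue_measure.-integrable `[0, x]
    (fun t : R => M%:E * ((x - t) `^ (a - 1) * t `^ (b - 1))%:E)%E.
  by apply: integrableZl => //; exact: integrable_beta.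
apply: le_integrable ib => //.
  apply: measurable_funTS; apply/measurable_EFinP/measurable_funM => //.
  by apply: (measurableT_comp (measurable_powR _)); exact: measurable_funB.
move=> t; rewrite /= in_itv/= => tx; rewrite lee_fin /RL_kernel.
rewrite [leRHS](_ : _ = (x - t) `^ (a - 1) * (`|M| * t `^ (b - 1))); last first.
  by rewrite !normrM !(ger0_norm (powR_ge0 _ _)); ring.
rewrite normrM (ger0_norm (powR_ge0 _ _)) ler_wpM2l ?powR_ge0//.
apply: le_trans (hN t tx) _; rewrite ler_wpM2r ?powR_ge0//.
exact: ler_norm.
Qed.

(** For [a = 1] the kernel [(x - t) `^ (a - 1)] is identically one, so that
    integrability on an interval is an instance of [RL_exists_bounded]. *)
Lemma integrable_on_finite_intervals_bounded (R : realType) (b : R) (N : R -> R) :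
  0 < b -> measurable_fun [set: R] N ->
  (forall x, 0 < x -> exists M, forall t, 0 <= t <= x ->
    `|N t| <= M * t `^ (b - 1)) ->
  integrable_on_finite_intervals N.
Proof.
move=> b0 mN hN x x0; have [M hM] := hN x x0.
have := RL_exists_bounded (@ltr01 R) b0 x0 mN hM.
apply: eq_integrable => // t _.
by rewrite /= /RL_kernel subrr powRr0 mul1r.
Qed.

(** Each summand is a Beta integral.  The endpoints are removed first, since
    merging the powers of [t] into one can fail at [t = 0]. *)
Lemma RL_integral_power_sum (R : realType) (a b x : R) (c : nat -> R) (n : nat) :
  0 < a -> 0 < b -> 0 < x ->
  (\int[mu]_(t in `[0%R, x]) ((x - t) `^ (a - 1) *
    (t `^ (b - 1) * \sum_(0 <= k < n) c k * (t `^ a) ^+ k))%:E =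
  (\sum_(0 <= k < n) c k * (x `^ (a + (a * k%:R + b) - 1) *
     (Gamma a * Gamma (a * k%:R + b) / Gamma (a + (a * k%:R + b)))))%:E)%E.
Proof.
move=> a0 b0 x0.
have mk : measurable_fun [set: R] (fun t => (x - t) `^ (a - 1)).
  by apply: (measurableT_comp (measurable_powR _)); exact: measurable_funB.
have bk0 k : 0 < a * k%:R + b by rewrite ltr_wpDl// mulr_ge0// ltW.
rewrite integral_itv_bndoo; last first.
  apply: measurable_funTS; apply/measurable_EFinP/measurable_funM => //.
  apply: measurable_funM; first exact: measurable_powR.
  apply: measurable_sum => k; apply: measurable_funM => //.
  by apply: measurable_funX; exact: measurable_powR.
pose h k (t : R) : \bar R :=
  ((c k)%:E * ((x - t) `^ (a - 1) * t `^ (a * k%:R + b - 1))%:E)%E.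
have ih0 k : lebesgue_measure.-integrable `]0, x[
    (EFin \o (fun t : R => (x - t) `^ (a - 1) * t `^ (a * k%:R + b - 1))).
  apply: integrableS (integrable_beta a0 (bk0 k) x0) => //.
  by apply: subset_itv; rewrite bnd_simp.
have ih k : lebesgue_measure.-integrable `]0, x[ (h k).
  by apply: integrableZl => //; exact: ih0.
transitivity (\int[mu]_(t in `]0%R, x[) \sum_(0 <= k < n) h k t)%E.
  apply: eq_integral => t; rewrite inE/= in_itv/= => /andP[t0 tx].
  transitivity (\sum_(0 <= k < n)
      c k * ((x - t) `^ (a - 1) * t `^ (a * k%:R + b - 1)))%:E; last first.
    by rewrite -sumEFin; apply: eq_bigr => k _; rewrite EFinM.
  congr EFin; rewrite !mulr_sumr; apply: eq_bigr => k _.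
  have -> : a * k%:R + b - 1 = (b - 1) + a * k%:R by ring.
  rewrite (@powRD _ t (b - 1)) ?(gt_eqF t0) ?implybT// powRrM powR_mulrn ?powR_ge0//.
  by ring.
rewrite (@integral_sum _ _ R mu _ (measurable_itv `]0, x[) _ h ih) -sumEFin; apply: eq_bigr => k _.
rewrite /h (integralZl _ (ih0 k))// EFinM; congr (_ * _)%E.
rewrite -beta_integral// [RHS]integral_itv_bndoo//.
exact: measurable_int (ih0 k).
Qed.

(** By [RL_integral_power_sum], [z] times the fractional integral of a partial
    sum is, by [ml_series_shift], the difference of the next partial sums for
    [d] and [d - 1].  Dominated convergence passes to the limit on the side of
    the integral, and convergence of the series on the other side. *)
Lemma ml_profile_fractional (R : realType) (C z d a b x : R) :
  0 < a -> 0 < b -> 0 < x ->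
  ml_profile C z d a b x - ml_profile C z (d - 1) a b x =
  z * RL_integral a (ml_profile C z d a b) x.
Proof.
move=> a0 b0 x0.
have G0 := Gamma_gt0 a0.
pose P := ml_partial C z d a b.
pose T n : R := C * x `^ (b - 1) * x `^ a * \sum_(0 <= k < n)
  pochhammer d k / (k`!%:R * Gamma (a + (a * k%:R + b))) * (z * x `^ a) ^+ k.
have intP n : (\int[mu]_(t in `[0%R, x]) (RL_kernel a (P n) x t)%:E =
    (Gamma a * T n)%:E)%E.
  transitivity (\int[mu]_(t in `[0%R, x]) ((x - t) `^ (a - 1) *
      (t `^ (b - 1) * \sum_(0 <= k < n) (C * (ml_coef d a b k * z ^+ k)) *
        (t `^ a) ^+ k))%:E)%E.
    apply: eq_integral => t _; rewrite /RL_kernel /P /ml_partial /series/=.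
    congr (_ * _)%:E; rewrite [C * _]mulrC -mulrA mulr_sumr; congr (_ * _).
    by apply: eq_bigr => k _; rewrite exprMn; ring.
  rewrite RL_integral_power_sum//; congr EFin.
  rewrite /T !mulr_sumr; apply: eq_bigr => k _.
  have s0 : 0 < a * k%:R + b by rewrite ltr_wpDl// mulr_ge0// ltW.
  have Gs := Gamma_gt0 s0.
  have Gas := Gamma_gt0 (addr_gt0 a0 s0).
  have f0 : (k`!%:R : R) != 0 by rewrite pnatr_eq0 -lt0n fact_gt0.
  have -> : a + (a * k%:R + b) - 1 = (b - 1) + a + a * k%:R by ring.
  rewrite powRD ?(gt_eqF x0) ?implybT// powRD ?(gt_eqF x0) ?implybT//.
  rewrite powRrM powR_mulrn ?powR_ge0// exprMn /ml_coef.
  move: (Gamma a) G0 (Gamma (a * _ + b)) Gs (Gamma (a + _)) Gas (k`!%:R) f0.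
  move: (pochhammer d k) (x `^ (b - 1)) (x `^ a) (_ ^+ k) (_ ^+ k).
  move=> p u v w y g1 g10 g2 g20 g3 g30 f f0.
  by field; rewrite f0 !gt_eqF.
have TE n : z * T n = C * x `^ (b - 1) *
    (series (fun k => ml_coef d a b k * (z * x `^ a) ^+ k) n.+1 -
     series (fun k => ml_coef (d - 1) a b k * (z * x `^ a) ^+ k) n.+1).
  by rewrite ml_series_shift /T; ring.
have cT : z * T n @[n --> \oo] -->
    ml_profile C z d a b x - ml_profile C z (d - 1) a b x.
  under eq_fun do rewrite TE mulrBr.
  have cP e := @ml_partial_cvg R C z e a b x a0 b0.
  by apply: cvgB; rewrite (cvg_shiftS (ml_partial C z _ a b ^~ x)); exact: cP.
have mK N : measurable_fun [set: R] N -> measurable_fun `[0, x]%classic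
    (fun t : R => (RL_kernel a N x t)%:E).
  move=> mN; apply/measurable_EFinP; apply: measurable_funTS.
  apply: measurable_funM => //.
  by apply: (measurableT_comp (measurable_powR _)); exact: measurable_funB.
have [M hM] := ml_partial_bounded C z d a0 b0 x0.
have ib : lebesgue_measure.-integrable `[0, x]
    (fun t : R => M%:E * ((x - t) `^ (a - 1) * t `^ (b - 1))%:E)%E.
  by apply: integrableZl => //; exact: integrable_beta.
have [|||||intK _ cvK] := @dominated_convergence _ _ R mu `[0%R, x]%classic
  (measurable_itv _) (fun n t => (RL_kernel a (P n) x t)%:E)
  (fun t => (RL_kernel a (ml_profile C z d a b) x t)%:E)
  (fun t : R => M%:E * ((x - t) `^ (a - 1) * t `^ (b - 1))%:E)%E.
- by move=> n; apply: mK; exact: measurable_ml_partial.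
- by apply: mK; exact: measurable_ml_profile.
- apply/aeW => t _; apply: cvg_EFin; first exact: nearW.
  by apply: cvgMr; exact: ml_partial_cvg.
- exact: ib.
- apply/aeW => t n; rewrite /= in_itv/= => tx; rewrite -EFinM lee_fin /RL_kernel.
  rewrite normrM (ger0_norm (powR_ge0 _ _)) mulrCA ler_wpM2l ?powR_ge0//.
  exact: hM.
have cT2 : z * T n @[n --> \oo] --> z * RL_integral a (ml_profile C z d a b) x.
  apply: cvgMr.
  have -> : T = fun n => (Gamma a)^-1 *
      fine (\int[mu]_(t in `[0%R, x]) (RL_kernel a (P n) x t)%:E)%E.
    by apply/funext => n; rewrite intP/= mulrA mulVf ?mul1r// gt_eqF.
  apply: cvgMr; apply: fine_cvg; rewrite fineK; first exact: cvK.
  by apply: integrable_fin_num => //; exact: intK.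
by rewrite -(cvg_lim (@Rhausdorff R) cT) (cvg_lim (@Rhausdorff R) cT2).
Qed.

(** * Comparison of two solutions *)

Lemma RL_integral_ae_eq (R : realType) (a x : R) (M N : R -> R) :
  RL_exists a M x -> RL_exists a N x ->
  {ae mu, forall t : R, 0 < t -> M t = N t} ->
  RL_integral a M x = RL_integral a N x.
Proof.
move=> /integrableP[mM _] /integrableP[mN _] MN.
congr (_ * fine _).
have sub : `]0, x]%classic `<=` (`[0, x]%classic : set R).
  by apply: subset_itvr; rewrite bnd_simp.
rewrite -integral_itv_obnd_cbnd; last exact: measurable_funS mM.
rewrite -integral_itv_obnd_cbnd; last exact: measurable_funS mN.
apply: ae_eq_integral => //.
- exact: measurable_funS mM.
- exact: measurable_funS mN.
- apply: (lebesgue_aeS _ MN) => t /= Mt; rewrite in_itv/= => /andP[t0 _].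
  by rewrite /RL_kernel Mt.
Qed.

(** The free term [f] cancels in the difference of two solutions, which
    therefore satisfies the homogeneous inequality of [fractional_gronwall]. *)
Lemma fractional_ae_unique (R : realType) (a c : R) (f M N : R -> R) :
  0 < a -> a < 1 -> 0 <= c -> ae_solution a c f M -> ae_solution a c f N ->
  {ae mu, forall x : R, 0 < x -> M x = N x}.
Proof.
move=> a0 a1 c0 [iM solM] [iN solN].
have G0 := Gamma_gt0 a0.
pose D x := M x - N x.
have iD : integrable_on_finite_intervals D.
  move=> b bgt0; have : lebesgue_measure.-integrable `[0, b]
      ((EFin \o M) \- (EFin \o N))%E.
    by apply: integrableB => //; [exact: iM|exact: iN].
  by apply: eq_integrable => // t _; rewrite /= -EFinB.
suff : {ae mu, forall x : R, 0 < x -> D x = 0}.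
  apply: lebesgue_aeS => x Dx x0; apply/eqP.
  by rewrite -subr_eq0 -/(D x) Dx.
apply: (@fractional_gronwall _ a (c / Gamma a)) => //.
  by rewrite divr_ge0// ltW.
have : {ae mu, forall x : R, (0 < x -> satisfies_at a c f M x) /\
    (0 < x -> satisfies_at a c f N x)}.
  exact: lebesgue_aeI.
apply: lebesgue_aeS => x [sM sN] x0.
have [exM eqM] := sM x0; have [exN eqN] := sN x0.
have exD : RL_exists a D x.
  have : lebesgue_measure.-integrable `[0, x]
      ((EFin \o RL_kernel a M x) \- (EFin \o RL_kernel a N x))%E.
    by apply: integrableB.
  apply: eq_integrable => // t _.
  by rewrite /= /RL_kernel -EFinB -mulrBr.
have intD : \int[mu]_(t in `[0, x]) RL_kernel a D x t =
    \int[mu]_(t in `[0, x]) RL_kernel a M x t -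
    \int[mu]_(t in `[0, x]) RL_kernel a N x t.
  rewrite -RintegralB//; apply: eq_Rintegral => t _.
  by rewrite /RL_kernel -mulrBr.
have -> : D x = - (c / Gamma a) * \int[mu]_(t in `[0, x]) RL_kernel a D x t.
  rewrite intD mulrBr /D.
  have -> : M x - N x = (M x - f x) - (N x - f x) by ring.
  by rewrite eqM eqN /RL_integral; ring.
have cG0 : 0 <= c / Gamma a by rewrite divr_ge0// ltW.
rewrite normrM normrN (ger0_norm cG0) EFinM lee_wpmul2l ?lee_fin//.
rewrite EFin_normr_Rintegral//.
apply: le_abse_integral => //.
by have /integrableP[] := exD.
Qed.

(** * Existence and uniqueness of the solution *)

Theorem mainTheorem2 (R : realType) (alpha gamma N0 : R)
    (alpha_gt0 : 0 < alpha) (alpha_lt1 : alpha < 1) (gamma_gt0 : 0 < gamma) :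
  let N := fun x : R =>
    N0 * x `^ (alpha * gamma - 1) * gamma `^ gamma *
    mittag_leffler gamma alpha (alpha * gamma) (- gamma * x `^ alpha) in
  let f := fun x : R =>
    N0 * x `^ (alpha * gamma - 1) * gamma `^ gamma *
    mittag_leffler (gamma - 1) alpha (alpha * gamma) (- gamma * x `^ alpha) in
  [/\ solution alpha gamma f N,
      (forall M : R -> R, solution alpha gamma f M ->
        forall x : R, 0 < x -> M x = N x)
    & (forall M : R -> R, ae_solution alpha gamma f M ->
        {ae lebesgue_measure, forall x : R, 0 < x -> M x = N x})].
Proof.
move=> N f.
have b0 : 0 < alpha * gamma by exact: mulr_gt0.
have NE d : (fun x => N0 * x `^ (alpha * gamma - 1) * gamma `^ gamma *
    mittag_leffler d alpha (alpha * gamma) (- gamma * x `^ alpha)) =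
    ml_profile (N0 * gamma `^ gamma) (- gamma) d alpha (alpha * gamma).
  by apply/funext => x; rewrite /ml_profile [N0 * _ * _]mulrAC.
have solN : solution alpha gamma f N.
  rewrite /f /N !NE; split.
    apply: (integrable_on_finite_intervals_bounded b0).
      exact: measurable_ml_profile.
    by move=> x x0; exact: ml_profile_bounded.
  move=> x x0; split; last exact: ml_profile_fractional.
  have [M hM] := ml_profile_bounded (N0 * gamma `^ gamma) (- gamma) gamma
    alpha_gt0 b0 x0.
  apply: (RL_exists_bounded alpha_gt0 b0 x0 _ hM).
  exact: measurable_ml_profile.
have aeuniq M : ae_solution alpha gamma f M ->
    {ae lebesgue_measure, forall x : R, 0 < x -> M x = N x}.
  move=> solM; apply: (fractional_ae_unique alpha_gt0 alpha_lt1 (ltW gamma_gt0) solM).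
  by split; [exact: solN.1|apply/aeW => y y0; exact: solN.2].
split=> // M solM x x0.
have MN : {ae lebesgue_measure, forall x : R, 0 < x -> M x = N x}.
  by apply: aeuniq; split; [exact: solM.1|apply/aeW => y y0; exact: solM.2].
have [exM eqM] := solM.2 x x0; have [exN eqN] := solN.2 x x0.
(* [M] and [N] agree almost everywhere, hence have the same fractional
   integral at each point, and the equation transfers this to [M x]. *)
have : RL_integral alpha M x = RL_integral alpha N x.
  exact: RL_integral_ae_eq.
by move=> RLE; move: eqM; rewrite RLE -eqN => /addIr.
Qed.
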